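(* Let $a,c>0$ be real numbers and let $\Gamma$ be the group of isometries of $\mathbb{E}^3$ (coordinates $(X,Y,Z)$) generated by the reflections $\gamma_0,\dots,\gamma_4$ in the planes $H_0:\ Z=0$, $H_1:\ Y=0$, $H_2:\ X=0$, $H_3:\ X+\sqrt3\,Y=a$, $H_4:\ Z=c/2$ respectively (so the vertical planes $H_1,H_2,H_3$ bound a triangular prism with angles $\angle(H_3,H_1)=\pi/6$, $\angle(H_1,H_2)=\pi/2$, $\angle(H_2,H_3)=\pi/3$). Let $u=H_0\cap H_1\cap H_2=(0,0,0)$ and $$v=\gamma_2\gamma_3(u)=\left(-\tfrac a2,\tfrac{\sqrt3 a}{2},0\right),\quad w=\gamma_2(v)=\left(\tfrac a2,\tfrac{\sqrt3 a}{2},0\right),$$ $$x=\gamma_1(w)=\left(\tfrac a2,-\tfrac{\sqrt3 a}{2},0\right),\quad y=\gamma_1(v)=\left(-\tfrac a2,-\tfrac{\sqrt3 a}{2},0\right).$$ For $p\in\{v,w,x,y\}$ write $p_1=p+(0,0,c)$ and $p_2=p-(0,0,c)$. Let $V=\Gamma(u)$ be the $\Gamma$-orbit of $u$, and let $E=\Gamma([u\,v_1])$ be the $\Gamma$-orbit of the segment $[u\,v_1]$. Let $z=\left(\tfrac{3a}{2},-\tfrac{\sqrt3 a}{2},0\right)$ and $t=(a,-\sqrt3 a,0)$; the points $y,u,z,t$ are the four points of $V\cap H_0$ nearest to $x$. Let $f$ be the infinite polygon (the ''zig-zag spiral'') with consecutive vertices $(p_k)_{k\in\mathbb{Z}}$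 given, for all $m\in\mathbb{Z}$, by $$p_{2m}=x-(0,0,2mc),\qquad p_{2m+1}=q_m-(0,0,(2m+1)c),$$ where $q_m=y,u,z,t$ according as $m\equiv 0,1,2,3 \pmod 4$, and with edges $[p_kp_{k+1}]$, $k\in\mathbb{Z}$. Then there is a fully transitive polyhedron $\mathcal{S}_1$ in $\mathbb{E}^3$ (the hexagonal zig-zag spiralhedron) with vertex set $V$ and edge set $E$, having $f$ as one of its faces, and whose vertex figure at $u$ is the cyclic polygon $[x_1\,x_2\,w_1\,w_2\,v_1\,v_2\,y_1\,y_2]$.
   Context: A finite polygon in $\mathbb{E}^3$ consists of distinct points $v_1,\dots,v_n$ (vertices) and the segments $[v_iv_{i+1}]$, $1\le i\le n-1$, and $[v_nv_1]$ (edges). An infinite polygon consists of distinct points $\dots,v_{-1},v_0,v_1,\dots$ and the segments $[v_iv_{i+1}]$, $i\in\mathbb{Z}$, such that each compact subset of $\mathbb{E}^3$ meets only finitely many of its edges. A (geometric) polyhedron is a triple $\mathcal{P}=(V,E,F)$ where $V$ is a set of points of $\mathbb{E}^3$ (vertices), $E$ is a set of segments with endpoints in $V$ (edges), and $F$ is a set of (finite or infinite) polygons (faces) whose edges are in $E$ and whose vertices are in $V$, such that: 1. each edge of one of the faces is an edge of exactly one other face; 2. each vertex of a face belongs to at least two other faces, and all the faces containing a given vertex form a single circuit, i.e. they can be labelled cyclically so that neighbouring faces share an edge (containing that vertex); 3. for any two edges $e,e'$ there is a chain $e=e_0,f_1,e_1,f_2,\dots,f_n,e_n=e'$ of edges and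 faces in which each face $f_i$ contains $e_{i-1}$ and $e_i$; 4. each compact subset of $\mathbb{E}^3$ meets only finitely many faces. A symmetry of $\mathcal{P}$ is an isometry of $\mathbb{E}^3$ that leaves $\mathcal{P}$ invariant (maps $V$, $E$, $F$ to themselves). $\mathcal{P}$ is fully transitive if its group of symmetries acts transitively on each of $V$, $E$ and $F$. The vertex figure of $\mathcal{P}$ at a vertex $u$ is the polygon $[v_1\dots v_q]$, where $v_1,\dots,v_q$ are the vertices of $\mathcal{P}$ adjacent to $u$ (joined to $u$ by an edge), cyclically ordered so that for each cyclically consecutive pair $v_k,v_{k+1}$ the edges $[uv_k]$ and $[uv_{k+1}]$ are consecutive edges of a common face. *)

(* Defs.v *)
From HB Require Import structures.
From mathcomp Require Import all_boot all_order all_algebra ring lra.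
From mathcomp Require Import all_classical all_reals all_analysis.

Set Implicit Arguments.
Unset Strict Implicit.
Unset Printing Implicit Defensive.

Import Order.TTheory GRing.Theory Num.Theory.
Import numFieldNormedType.Exports.

Local Open Scope classical_set_scope.
Local Open Scope ring_scope.

Section Euclidean.
Variable R : realType.
Implicit Types (p q n : 'rV[R]_3) (g : 'rV[R]_3 -> 'rV[R]_3).

Definition pt (X Y Z : R) : 'rV[R]_3 := \row_(i < 3) [:: X; Y; Z]`_i.

Definition dot p q : R := \sum_(i < 3) p 0 i * q 0 i.

(* The library norm on row vectors is the sup norm, hence this distance; both
   induce the same topology, so the library's [compact] is the usual one. *)
Definition edist p q : R := Num.sqrt (dot (p - q) (p - q)).

(* Distance-preserving self-maps of Euclidean 3-space are bijective. *)
Definition euclidean_isometry g := forall p q, edist (g p) (g q) = edist p q.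

Definition segment p q : set 'rV[R]_3 :=
  [set (1 - s) *: p + s *: q | s in `[0, 1]].

Definition plane n (d : R) : set 'rV[R]_3 := [set p | dot n p = d].

Definition reflection n (d : R) p : 'rV[R]_3 :=
  p - (2 * (dot n p - d) / dot n n) *: n.

Inductive generated (G : set ('rV[R]_3 -> 'rV[R]_3)) :
    set ('rV[R]_3 -> 'rV[R]_3) :=
| generated_id : generated G id
| generated_gen g : G g -> generated G g
| generated_comp g h : generated G g -> generated G h -> generated G (g \o h)
| generated_inv g h :
    generated G g -> cancel g h -> cancel h g -> generated G h.

End Euclidean.

Section Polyhedra.
Variable R : realType.
Local Notation E3 := 'rV[R]_3.

Record polygon := Polygon { pverts : set E3; pedges : set (set E3) }.

(* [ordS] is the cyclic successor. *)
Definition finite_polygon n (p : 'I_n -> E3) : polygon :=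
  Polygon (range p) (range (fun i => segment (p i) (p (ordS i)))).

Definition infinite_polygon (p : int -> E3) : polygon :=
  Polygon (range p) (range (fun i : int => segment (p i) (p (i + 1)))).

Definition locally_finite (A : set (set E3)) :=
  forall K : set E3, compact K -> finite_set [set e | A e /\ e `&` K !=set0].

Definition is_polygon (f : polygon) : Prop :=
  (exists n (p : 'I_n -> E3),
     [/\ (3 <= n)%N, injective p & f = finite_polygon p]) \/
  (exists p : int -> E3,
     [/\ injective p, f = infinite_polygon p & locally_finite (pedges f)]).

Definition consecutive_edges (f : polygon) (e e' : set E3) : Prop :=
  (exists n (p : 'I_n -> E3) (i : 'I_n),
     [/\ (3 <= n)%N, injective p, f = finite_polygon p,
         e = segment (p i) (p (ordS i)) &
         e' = segment (p (ordS i)) (p (ordS (ordS i)))]) \/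
  (exists (p : int -> E3) (i : int),
     [/\ injective p, f = infinite_polygon p,
         e = segment (p i) (p (i + 1)) &
         e' = segment (p (i + 1)) (p (i + 2))]).

Definition incident (v : E3) (e : set E3) : Prop :=
  exists w, w <> v /\ e = segment v w.

Definition meets (f : polygon) (K : set E3) : Prop :=
  exists2 e, pedges f e & e `&` K !=set0.

Record prepolyhedron :=
  Prepolyhedron { verts : set E3; edges : set (set E3); faces : set polygon }.

Implicit Types P : prepolyhedron.

Definition edges_in_two_faces P := forall f e, faces P f -> pedges f e ->
  exists! f', [/\ faces P f', f' <> f & pedges f' e].

Definition vertices_in_three_faces P := forall f v, faces P f -> pverts f v ->
  exists f1 f2, [/\ faces P f1 /\ pverts f1 v, faces P f2 /\ pverts f2 v,
                    f1 <> f, f2 <> f & f1 <> f2].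

Definition single_circuit_at P (v : E3) := exists n (g : 'I_n -> polygon),
  [/\ (0 < n)%N, injective g, range g = [set f | faces P f /\ pverts f v] &
      forall i, exists e,
        [/\ pedges (g i) e, pedges (g (ordS i)) e & incident v e]].

Definition edge_chain_connected P := forall e e', edges P e -> edges P e' ->
  exists (n : nat) (es : nat -> set E3) (fs : nat -> polygon),
    [/\ es 0%N = e, es n = e', forall i, (i <= n)%N -> edges P (es i) &
        forall i, (i < n)%N ->
          [/\ faces P (fs i), pedges (fs i) (es i) &
              pedges (fs i) (es i.+1)]].

Definition finitely_many_faces_meet P := forall K : set E3, compact K ->
  finite_set [set f | faces P f /\ meets f K].

Record is_polyhedron P : Prop := IsPolyhedron {
  polyhedron_edges : forall e, edges P e ->
    exists v w, [/\ verts P v, verts P w, v <> w & e = segment v w];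
  polyhedron_faces : forall f, faces P f ->
    [/\ is_polygon f, pverts f `<=` verts P & pedges f `<=` edges P];
  polyhedron_edges_in_two_faces : edges_in_two_faces P;
  polyhedron_vertices_in_three_faces : vertices_in_three_faces P;
  polyhedron_single_circuit : forall v, verts P v -> single_circuit_at P v;
  polyhedron_chain_connected : edge_chain_connected P;
  polyhedron_discrete : finitely_many_faces_meet P }.

Definition map_polygon (g : E3 -> E3) (f : polygon) : polygon :=
  Polygon (g @` pverts f) [set g @` e | e in pedges f].

Definition symmetry P (g : E3 -> E3) : Prop :=
  [/\ euclidean_isometry g, g @` verts P = verts P,
      [set g @` e | e in edges P] = edges P &
      [set map_polygon g f | f in faces P] = faces P].

Definition fully_transitive P : Prop :=
  [/\ forall v w, verts P v -> verts P w ->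
        exists2 g, symmetry P g & g v = w,
      forall e e', edges P e -> edges P e' ->
        exists2 g, symmetry P g & g @` e = e' &
      forall f f', faces P f -> faces P f' ->
        exists2 g, symmetry P g & map_polygon g f = f'].

Definition adjacent P (v w : E3) : Prop :=
  [/\ verts P v, verts P w, v <> w & edges P (segment v w)].

Definition is_vertex_figure P (v : E3) (Q : polygon) : Prop :=
  exists n (p : 'I_n -> E3),
    [/\ (3 <= n)%N, injective p, range p = [set w | adjacent P v w],
        forall k, exists2 f, faces P f &
          consecutive_edges f (segment v (p k)) (segment v (p (ordS k))) &
        Q = finite_polygon p].

End Polyhedra.

Section HexagonalZigzag.
Variables (R : realType) (a c : R).
Local Notation sqrt3 := (Num.sqrt (3 : R)).

Definition gamma0 := reflection (pt 0 0 1 : 'rV[R]_3) 0.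
Definition gamma1 := reflection (pt 0 1 0 : 'rV[R]_3) 0.
Definition gamma2 := reflection (pt 1 0 0 : 'rV[R]_3) 0.
Definition gamma3 := reflection (pt 1 sqrt3 0) a.
Definition gamma4 := reflection (pt 0 0 1) (c / 2).

Definition Gamma : set ('rV[R]_3 -> 'rV[R]_3) :=
  generated [set gamma0; gamma1; gamma2; gamma3; gamma4].

Definition pu : 'rV[R]_3 := pt 0 0 0.
Definition pv := pt (- (a / 2)) (sqrt3 * a / 2) 0.
Definition pw := pt (a / 2) (sqrt3 * a / 2) 0.
Definition px := pt (a / 2) (- (sqrt3 * a / 2)) 0.
Definition py := pt (- (a / 2)) (- (sqrt3 * a / 2)) 0.
Definition pz := pt (3 * a / 2) (- (sqrt3 * a / 2)) 0.
Definition ptt := pt a (- (sqrt3 * a)) 0.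

Definition up (p : 'rV[R]_3) := p + pt 0 0 c.
Definition down (p : 'rV[R]_3) := p - pt 0 0 c.

Definition V : set 'rV[R]_3 := [set g pu | g in Gamma].
Definition E : set (set 'rV[R]_3) := [set g @` segment pu (up pv) | g in Gamma].

Definition spiral_side (m : int) : 'rV[R]_3 :=
  [:: py; pu; pz; ptt]`_`|(m %% 4)%Z|%N.

Definition spiral (k : int) : 'rV[R]_3 :=
  (if (k %% 2)%Z == 0 then px else spiral_side (k %/ 2)%Z) - pt 0 0 (k%:~R * c).

(* The cyclic polygon [x1 x2 w1 w2 v1 v2 y1 y2]. *)
Definition octagon : polygon R :=
  finite_polygon (tnth [tuple up px; down px; up pw; down pw;
                              up pv; down pv; up py; down py]).

Lemma dot_pt (X Y Z X' Y' Z' : R) :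
  dot (pt X Y Z) (pt X' Y' Z') = X * X' + Y * Y' + Z * Z'.
Proof. by rewrite /dot 3!big_ord_recl big_ord0 !mxE /= addr0 addrA. Qed.

Lemma reflection_pt (A B C d X Y Z : R) :
  let k := 2 * (A * X + B * Y + C * Z - d) / (A * A + B * B + C * C) in
  reflection (pt A B C) d (pt X Y Z) = pt (X - k * A) (Y - k * B) (Z - k * C).
Proof.
rewrite /reflection !dot_pt /=; apply/rowP => -[[|[|[|//]]] ?]; by rewrite !mxE.
Qed.

Lemma pu_planes :
  plane (pt 0 0 1) 0 `&` plane (pt 0 1 0) 0 `&` plane (pt 1 0 0) 0 = [set pu].
Proof.
apply/seteqP; split=> [p|p ->]; last first.
  by rewrite /plane /= !dot_pt !(mulr0, addr0).
rewrite /plane /dot /= !big_ord_recl !big_ord0 !mxE /=.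
rewrite !(mul0r, mul1r, add0r, addr0) => -[[p2 p1] p0].
apply/rowP => -[[|[|[|//]]] i3]; rewrite mxE /=; [rewrite -p0|rewrite -p1|rewrite -p2];
  by congr (p 0 _); apply: val_inj.
Qed.

Lemma pvE : pv = gamma2 (gamma3 pu).
Proof.
have s3 : sqrt3 * sqrt3 = 3 by rewrite -expr2 sqr_sqrtr.
rewrite /gamma2 /gamma3 !reflection_pt s3 /pv; congr pt; by field.
Qed.

Lemma pwE : pw = gamma2 pv.
Proof. by rewrite /gamma2 reflection_pt /pw; congr pt; field. Qed.

Lemma pxE : px = gamma1 pw.
Proof. by rewrite /gamma1 reflection_pt /px; congr pt; field. Qed.

Lemma pyE : py = gamma1 pv.
Proof. by rewrite /gamma1 reflection_pt /py; congr pt; field. Qed.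

Lemma spiral_even (m : int) : spiral (2 * m) = px - pt 0 0 ((2 * m)%:~R * c).
Proof. by rewrite /spiral modzMr eqxx. Qed.

Lemma spiral_odd (m : int) :
  spiral (2 * m + 1) = spiral_side m - pt 0 0 ((2 * m + 1)%:~R * c).
Proof.
rewrite /spiral [2 * m]mulrC modzMDl /=.
by rewrite divzMDl // divz_small // addr0.
Qed.

End HexagonalZigzag.

(* Main.v *)
Require Import Defs.
From mathcomp Require Import all_boot all_order all_algebra ring lra zify.
From mathcomp Require Import all_classical all_reals all_analysis.
From Stdlib Require Import Relation_Operators Operators_Properties.

(* V is K x cZ, where K is the set of vertices of the trihexagonal tiling of the
   plane Z = 0, and E joins (p, l) to (q, l + 1) and (q, l - 1) whenever p and q
   are adjacent in K. The faces are the zig-zag spirals descending around the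
   vertical line through a site p, clockwise if the levels of the vertices on
   that line are even and counterclockwise if they are odd. An edge lies in
   exactly two of them, one around each of its endpoints, and eight of them meet
   at each vertex: four around it and one around each neighbouring site.
   The reflections gamma0, ..., gamma3 reverse chirality while gamma4, which
   exchanges even and odd levels, preserves the alternating pattern. Hence the
   products of generators with an even number of factors among
   gamma0, ..., gamma3 are symmetries. The alternation is essential: with all
   spirals of one chirality the symmetry group has two orbits of edges. *)

Set Implicit Arguments.
Unset Strict Implicit.
Unset Printing Implicit Defensive.

Import Order.TTheory GRing.Theory Num.Theory.
Import numFieldNormedType.Exports.

Local Open Scope classical_set_scope.
Local Open Scope ring_scope.

(** * Trihexagonal sites and spirals *)

Lemma int_parity (k : int) : exists m, k = 2 * m \/ k = 2 * m + 1.
Proof. by exists (k %/ 2)%Z; lia. Qed.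

(* Let b1, b2 be the vectors of length a in the directions 0 and 60 degrees. The
   sites (KA, m, n), (KB, m, n), (KC, m, n) are the points 2 m b1 + 2 n b2,
   2 m b1 + (2 n + 1) b2 and (2 m + 1) b1 + (2 n + 1) b2; the missing class
   (2 m + 1) b1 + 2 n b2 consists of the centres of the hexagons. *)
Inductive kind := KA | KB | KC.

Definition site : Type := kind * int * int.

Definition vertex : Type := site * int.

(* The four neighbours of a site, in clockwise order. *)
Definition nbr (p : site) (j : 'Z_4) : site :=
  let: (t, m, n) := p in
  match t, val j with
  | KA, 0%N => (KB, m, n - 1)
  | KA, 1%N => (KC, m - 1, n)
  | KA, 2%N => (KB, m, n)
  | KA, _ => (KC, m, n - 1)
  | KB, 0%N => (KC, m - 1, n)
  | KB, 1%N => (KA, m, n + 1)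
  | KB, 2%N => (KC, m, n)
  | KB, _ => (KA, m, n)
  | KC, 0%N => (KB, m, n)
  | KC, 1%N => (KA, m, n + 1)
  | KC, 2%N => (KB, m + 1, n)
  | KC, _ => (KA, m + 1, n)
  end.

(** Elimination into numerals, on which the tables [nbr] and [back] compute. *)
Lemma Z4_cases (P : 'Z_4 -> Prop) : P 0 -> P 1 -> P 2 -> P 3 -> forall j, P j.
Proof.
move=> P0 P1 P2 P3 [[|[|[|[|//]]]] j4].
- by have -> : Ordinal j4 = 0 by apply: val_inj.
- by have -> : Ordinal j4 = 1 by apply: val_inj.
- by have -> : Ordinal j4 = 2 by apply: val_inj.
- by have -> : Ordinal j4 = 3 by apply: val_inj.
Qed.

Lemma nbr_inj p : injective (nbr p).
Proof.
case: p => [[t m] n].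
by case: t; elim/Z4_cases; elim/Z4_cases => //= -[*]; exfalso; lia.
Qed.

Lemma nbr_neq p j : nbr p j <> p.
Proof. by case: p => [[t m] n]; case: t; elim/Z4_cases: j. Qed.

(** The position of [p] among the neighbours of [nbr p j]; [nbr_back] checks the table. *)
Definition back (p : site) (j : 'Z_4) : 'Z_4 :=
  match p.1.1, val j with
  | KA, 0%N | KA, 3%N => 1
  | KA, _ => 3
  | KB, 0%N | KB, 3%N => 2
  | KB, _ => 0
  | KC, 0%N => 2
  | KC, 1%N => 3
  | KC, 2%N => 0
  | KC, _ => 1
  end.

Lemma nbr_back p j : nbr (nbr p j) (back p j) = p.
Proof.
case: p => [[t m] n].
by case: t; elim/Z4_cases: j => /=; congr (_, _, _); lia.
Qed.

(* The chirality of the spirals whose axial vertices lie on levels of the parity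
   of l: clockwise for even l if b is false. *)
Definition chi (b : bool) (l : int) : 'Z_4 :=
  if ((l %% 2)%Z == 0) (+) b then 1 else -1.

Lemma chi_addn2 b l m : chi b (l + 2 * m) = chi b l.
Proof. by rewrite /chi addrC mulrC modzMDl. Qed.
Lemma chi_subn2 b l m : chi b (l - 2 * m) = chi b l.
Proof. by rewrite -mulrN chi_addn2. Qed.

Lemma chiN b l : chi b (- l) = chi b l.
Proof. by rewrite -(chi_addn2 _ (- l) l); congr chi; ring. Qed.

Lemma chiD1 b l : chi b (l + 1) = - chi b l.
Proof.
rewrite /chi; have [m [->|->]] := int_parity l.
  by rewrite mulrC modzMDl modzMl /=; case: b => //=; rewrite opprK.
rewrite -addrA mulrC !modzMDl /=; by case: b => //=; rewrite opprK.
Qed.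
Lemma chiB1 b l : chi b (l - 1) = - chi b l.
Proof. by rewrite -[X in - chi b X](subrK 1) chiD1 opprK. Qed.

Lemma chiNb b l : chi (~~ b) l = - chi b l.
Proof. by rewrite /chi addbN if_neg; case: ifP; rewrite ?opprK. Qed.

Lemma chi_neq0 b l : chi b l != 0.
Proof. by rewrite /chi; case: ifP. Qed.

Lemma chi_sqr b l : chi b l * chi b l = 1.
Proof. by rewrite /chi; case: ifP; rewrite ?mulrNN mulr1. Qed.

(** Vertex number 0 is [v], on the axis, and [phi] is the direction of vertex number 1. Each step
    goes down one level, even numbers stay on the axis, and from one odd number to the next the
    direction turns by [chi]. *)
Definition spiral_vertex (b : bool) (v : vertex) (phi : 'Z_4) (k : int)
  : vertex :=
  (if (k %% 2)%Z == 0 then v.1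
   else nbr v.1 (phi + chi b v.2 * (k %/ 2)%Z%:~R), v.2 - k).

Lemma spiral_vertex_even b v phi m :
  spiral_vertex b v phi (2 * m) = (v.1, v.2 - 2 * m).
Proof. by rewrite /spiral_vertex mulrC modzMl. Qed.

Lemma spiral_vertex_odd b v phi m :
  spiral_vertex b v phi (2 * m + 1) =
  (nbr v.1 (phi + chi b v.2 * m%:~R), v.2 - (2 * m + 1)).
Proof.
rewrite /spiral_vertex mulrC modzMDl /=.
by rewrite divzMDl // divz_small // addr0.
Qed.

(** Taking the axial vertex number [2 * m] as the new base point renumbers the same spiral, whose
    direction has meanwhile turned [m] times. *)
Lemma spiral_vertex_shift b p l phi m k :
  spiral_vertex b (p, l) phi (k + 2 * m) =
  spiral_vertex b (p, l - 2 * m) (phi + chi b l * m%:~R) k.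
Proof.
have [q [->|->]] := int_parity k.
  by rewrite -mulrDr !spiral_vertex_even /=; congr pair; ring.
have -> : 2 * q + 1 + 2 * m = 2 * (q + m) + 1 by ring.
rewrite !spiral_vertex_odd /= chi_subn2; congr (nbr _ _, _); last by ring.
by rewrite rmorphD /=; ring.
Qed.

Definition step (v : vertex) (s : bool) (j : 'Z_4) : vertex :=
  (nbr v.1 j, if s then v.2 + 1 else v.2 - 1).

Lemma step_inj v s j s' j' : step v s j = step v s' j' -> s = s' /\ j = j'.
Proof.
move=> [/nbr_inj -> h]; split=> //; case: s s' h => [] [] //; lia.
Qed.

Lemma step_back v s j : step (step v s j) (~~ s) (back v.1 j) = v.
Proof.
case: v => p l; rewrite /step /= nbr_back; congr pair.
by case: s => /=; lia.
Qed.

Lemma spiral_vertex0 b v phi : spiral_vertex b v phi 0 = v.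
Proof. by rewrite /spiral_vertex /= subr0; case: v. Qed.

Lemma spiral_vertex1 b v phi : spiral_vertex b v phi 1 = step v false phi.
Proof. by rewrite /spiral_vertex /= mulr0 addr0. Qed.

Lemma spiral_vertexN1 b v phi :
  spiral_vertex b v phi (- 1) = step v true (phi - chi b v.2).
Proof.
rewrite [in LHS](_ : -1 = 2 * (-1) + 1) // spiral_vertex_odd.
by rewrite /step mulrN1; congr pair; ring.
Qed.

(** * Segments, reflections and infinite polygons *)

Section Space.
Variable R : realType.
Implicit Types (p q n : 'rV[R]_3) (g : 'rV[R]_3 -> 'rV[R]_3).

Lemma ptE p : exists X Y Z, p = pt X Y Z.
Proof.
exists (p 0 0), (p 0 1), (p 0 2).
by apply/rowP => -[[|[|[|//]]] ?]; rewrite !mxE /=; congr (p _ _); apply: val_inj.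
Qed.

Lemma pt_inj (X Y Z X' Y' Z' : R) :
  pt X Y Z = pt X' Y' Z' -> [/\ X = X', Y = Y' & Z = Z'].
Proof.
by move=> /rowP e; move: (e 0) (e 1) (e 2); rewrite !mxE.
Qed.

Lemma ptD (X Y Z X' Y' Z' : R) :
  pt X Y Z + pt X' Y' Z' = pt (X + X') (Y + Y') (Z + Z').
Proof. by apply/rowP => -[[|[|[|//]]] ?]; rewrite !mxE. Qed.

Lemma ptN (X Y Z : R) : - pt X Y Z = pt (- X) (- Y) (- Z).
Proof. by apply/rowP => -[[|[|[|//]]] ?]; rewrite !mxE. Qed.

Lemma ptZ (k X Y Z : R) : k *: pt X Y Z = pt (k * X) (k * Y) (k * Z).
Proof. by apply/rowP => -[[|[|[|//]]] ?]; rewrite !mxE. Qed.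

Lemma segmentC p q : segment p q = segment q p.
Proof.
suff sub p' q' : segment p' q' `<=` segment q' p' by apply/seteqP; split.
move=> x [s /=]; rewrite in_itv /= => /andP[s0 s1] <-.
exists (1 - s); first by rewrite /= in_itv /=; apply/andP; split; lra.
by rewrite opprB addrCA subrr addr0 addrC.
Qed.

Lemma segment_left p q : segment p q p.
Proof.
exists 0; first by rewrite /= in_itv /= lexx ler01.
by rewrite subr0 scale1r scale0r addr0.
Qed.

Lemma segment_right p q : segment p q q.
Proof. by rewrite segmentC; apply: segment_left. Qed.

(* Each endpoint of one segment is p + r (q - p) on the other, and the two
   length ratios multiply to 1, so both are 1 in absolute value. *)
Lemma segment_inj p q p' q' : p <> q -> segment p q = segment p' q' ->
  (p = p' /\ q = q') \/ (p = q' /\ q = p').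
Proof.
move=> npq e.
have [s /= + sE] : segment p' q' p by rewrite -e; apply: segment_left.
have [t /= + tE] : segment p' q' q by rewrite -e; apply: segment_right.
have [r /= + rE] : segment p q p' by rewrite e; apply: segment_left.
have [k /= + kE] : segment p q q' by rewrite e; apply: segment_right.
rewrite !in_itv /= => /andP[k0 k1] /andP[r0 r1] /andP[t0 t1] /andP[s0 s1].
have eq1 : (1 - (t - s) * (k - r)) *: (q - p) = 0.
  have -> : (1 - (t - s) * (k - r)) *: (q - p) =
      (q - p) - (t - s) *: (((1 - k) *: p + k *: q) - ((1 - r) *: p + r *: q)).
    by apply/rowP => i; rewrite !mxE; ring.
  have -> : q - p = (t - s) *: (q' - p').
    by rewrite -sE -tE; apply/rowP => i; rewrite !mxE; ring.
  by rewrite kE rE subrr.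
have : 1 = (t - s) * (k - r).
  apply/eqP; rewrite -subr_eq0; apply: contra_notT npq => nz.
  apply/esym/eqP; rewrite -subr_eq0; move/eqP: eq1.
  by rewrite scaler_eq0 (negbTE nz).
move=> e1.
have [[s_ t_]|[s_ t_]] : (s = 0 /\ t = 1) \/ (s = 1 /\ t = 0).
  by case: (lerP s t) => st; [left|right]; split; nra.
- left; rewrite -sE -tE s_ t_ subrr subr0 !scale0r !scale1r addr0 add0r.
  by [].
- right; rewrite -sE -tE s_ t_ subrr subr0 !scale0r !scale1r addr0 add0r.
  by [].
Qed.

Definition affine g := forall s p q,
  g ((1 - s) *: p + s *: q) = (1 - s) *: g p + s *: g q.

Lemma affine_segment g p q : affine g ->
  g @` segment p q = segment (g p) (g q).
Proof.
move=> ag; apply/seteqP; split=> [_ [_ [s hs <-] <-]|_ [s hs <-]].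
  by exists s; rewrite // ag.
by exists ((1 - s) *: p + s *: q); [exists s|rewrite ag].
Qed.

Lemma reflection_affine n d : affine (reflection n d).
Proof.
have [A [B [C ->]]] := ptE n => s p q.
have [X [Y [Z ->]]] := ptE p; have [X' [Y' [Z' ->]]] := ptE q.
rewrite !ptZ !ptD !reflection_pt !ptZ !ptD.
by congr pt; ring.
Qed.

Lemma reflectionK n d : dot n n != 0 -> involutive (reflection n d).
Proof.
have [A [B [C ->]]] := ptE n; rewrite dot_pt => nz p.
by have [X [Y [Z ->]]] := ptE p; rewrite !reflection_pt; congr pt; field.
Qed.

Lemma reflection_isometry n d :
  dot n n != 0 -> euclidean_isometry (reflection n d).
Proof.
have [A [B [C ->]]] := ptE n; rewrite dot_pt => nz p q.
have [X [Y [Z ->]]] := ptE p; have [X' [Y' [Z' ->]]] := ptE q.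
rewrite /Defs.edist !reflection_pt /= !ptN !ptD !dot_pt; congr Num.sqrt.
by field.
Qed.

(** A [polygon] keeps only the sets of its vertices and edges, so it does not depend on the origin
    or the sense of its numbering. *)
Lemma infinite_polygon_shift (p : int -> 'rV[R]_3) t :
  infinite_polygon (fun k => p (k + t)) = infinite_polygon p.
Proof.
congr Polygon; apply/seteqP; split=> _ [k _ <-].
- by exists (k + t).
- by exists (k - t); rewrite ?subrK.
- by exists (k + t) => //; congr segment; congr p; ring.
- by exists (k - t) => //; congr segment; congr p; ring.
Qed.

Lemma infinite_polygon_rev (p : int -> 'rV[R]_3) :
  infinite_polygon (fun k => p (- k)) = infinite_polygon p.
Proof.
congr Polygon; apply/seteqP; split=> _ [k _ <-].
- by exists (- k).
- by exists (- k); rewrite ?opprK.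
- by exists (- (k + 1)); rewrite // segmentC; congr segment; congr p; ring.
- by exists (- (k + 1)); rewrite // segmentC; congr segment; congr p; ring.
Qed.

Lemma map_infinite_polygon g (p : int -> 'rV[R]_3) : affine g ->
  map_polygon g (infinite_polygon p) = infinite_polygon (fun k => g (p k)).
Proof.
move=> ag; congr Polygon; apply/seteqP; split.
- by move=> _ [_ [k _ <-] <-]; exists k.
- by move=> _ [k _ <-]; exists (p k) => //; exists k.
- by move=> _ [_ [k _ <-] <-]; exists k => //; rewrite affine_segment.
- move=> _ [k _ <-]; exists (segment (p k) (p (k + 1))); first by exists k.
  by rewrite affine_segment.
Qed.

End Space.

(** * Embedded spirals *)

(** Two off-axis vertices of a spiral that are two levels apart have directions differing by [chi],
    which is nonzero, so they lie over different sites. This recovers the axis from the set of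
    vertices. *)
Lemma site_eq_of_column b v phi p l k k' :
  spiral_vertex b v phi k = (p, l) -> spiral_vertex b v phi k' = (p, l + 2) ->
  p = v.1.
Proof.
have [m [->|->]] := int_parity k; first by rewrite spiral_vertex_even => -[->].
rewrite spiral_vertex_odd => -[ep el].
have [m' [->|->]] := int_parity k'; first by rewrite spiral_vertex_even => -[->].
rewrite spiral_vertex_odd -ep => -[/nbr_inj /addrI e el'].
have mE : m = m' + 1 by lia.
move: e; rewrite mE rmorphD /= mulrDr mulr1 => /eqP.
by rewrite -subr_eq0 opprD addrA subrr add0r oppr_eq0 (negPf (chi_neq0 _ _)).
Qed.

(* Coordinates in units of a / 2 and sqrt 3 a / 2. *)
Definition site_x (p : site) : int :=
  let: (t, m, n) := p in
  4 * m + 2 * n + match t with KA => 0 | KB => 1 | KC => 3 end.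

Definition site_y (p : site) : int :=
  let: (t, m, n) := p in 2 * n + match t with KA => 0 | _ => 1 end.

(** The parity of [site_y] separates [KA] from the other kinds, and [site_x - site_y] modulo 4
    separates [KB] from [KC]. *)
Lemma site_xy_inj p q : site_x p = site_x q -> site_y p = site_y q -> p = q.
Proof.
by case: p q => [[[] m] n] [[[] m'] n'] /= ex ey; (exfalso; lia) ||
  (congr (_, _, _); lia).
Qed.

Section Embedding.
Variables (R : realType) (a c : R).
Hypotheses (ha : 0 < a) (hc : 0 < c).
Local Notation sqrt3 := (Num.sqrt (3 : R)).

Definition place (v : vertex) : 'rV[R]_3 :=
  pt ((site_x v.1)%:~R * (a / 2)) ((site_y v.1)%:~R * (sqrt3 * a / 2))
     (v.2%:~R * c).

Lemma place_inj : injective place.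
Proof.
move=> [p l] [q l'] /pt_inj [/= ex ey ez].
have s3 : 0 < sqrt3 by rewrite sqrtr_gt0.
congr pair.
  apply: site_xy_inj; apply/(@intr_inj R); [move: ex|move: ey];
    by apply: mulIf; rewrite gt_eqF // divr_gt0 // mulr_gt0.
by apply/(@intr_inj R); move: ez; apply: mulIf; rewrite gt_eqF.
Qed.

(** An edge labelled from one of its endpoints, going up if [s] is true; it has one label for each
    endpoint, by [link_inj] and [link_back]. *)
Definition link v s j := segment (place v) (place (step v s j)).

Lemma step_neq v s j : step v s j <> v.
Proof. by case: v => p l [/nbr_neq]. Qed.

Lemma link_inj v s j v' s' j' : link v s j = link v' s' j' ->
  [/\ v = v', s = s' & j = j'] \/ (v' = step v s j /\ v = step v' s' j').
Proof.
move=> /segment_inj [].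
- by move=> /place_inj/esym/step_neq.
- move=> [/place_inj <- /place_inj/step_inj [<- <-]]; by left.
- by move=> [/place_inj <- /place_inj <-]; right.
Qed.

Lemma link_back v s j : link (step v s j) (~~ s) (back v.1 j) = link v s j.
Proof. by rewrite /link step_back segmentC. Qed.

Variable b : bool.

Definition face v phi : polygon R :=
  infinite_polygon (fun k => place (spiral_vertex b v phi k)).

Lemma spiral_vertex_inj v phi : injective (spiral_vertex b v phi).
Proof. by move=> k k' [_] /addrI/oppr_inj. Qed.

Lemma face_shift p l phi m :
  face (p, l) phi = face (p, l - 2 * m) (phi + chi b l * m%:~R).
Proof.
rewrite /face -(infinite_polygon_shift _ (2 * m)); congr infinite_polygon.
by apply/funext => k; rewrite spiral_vertex_shift.
Qed.

(* The face around the site of v that contains [link v s j]. *)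
Definition axial_face v s j := face v (if s then j + chi b v.2 else j).

Lemma axial_face_link v s j : pedges (axial_face v s j) (link v s j).
Proof.
case: s; rewrite /axial_face /link /=.
  by exists (- 1) => //; rewrite addNr spiral_vertex0 spiral_vertexN1 addrK segmentC.
by exists 0 => //; rewrite add0r spiral_vertex0 spiral_vertex1.
Qed.

(** Every edge of a spiral has exactly one endpoint on the axis, and labelling it from there
    exhibits the spiral as an axial face. *)
Lemma face_edge v phi e : pedges (face v phi) e <->
  exists v' s j, e = link v' s j /\ face v phi = axial_face v' s j.
Proof.
case: v => p l; split=> [[k _ <-]|[v' [s [j [-> ->]]]]]; last first.
  exact: axial_face_link.
have [m [->|->]] := int_parity k.
  exists (p, l - 2 * m), false, (phi + chi b l * m%:~R).
  rewrite /axial_face -face_shift /link /step spiral_vertex_even.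
  by rewrite spiral_vertex_odd /= opprD addrA.
(* Edge number [2 * m + 1] ends on the axis at vertex number [2 * (m + 1)], from which it goes
   up. *)
exists (p, l - 2 * (m + 1)), true, (phi + chi b l * m%:~R).
have -> : 2 * m + 1 + 1 = 2 * (m + 1) by ring.
rewrite /link /step spiral_vertex_even spiral_vertex_odd /= segmentC; split.
  by congr segment; congr place; congr pair; ring.
rewrite /axial_face (face_shift _ _ _ (m + 1)) /= chi_subn2; congr face.
by rewrite rmorphD /=; ring.
Qed.

Lemma face_centre v phi : pverts (face v phi) (place v).
Proof.
by exists 0; rewrite // spiral_vertex0.
Qed.

(** A face has vertices two levels apart over its axis, and over no other site by
    [site_eq_of_column]. *)
Lemma face_shared_site v phi v' phi' : face v phi = face v' phi' -> v.1 = v'.1.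
Proof.
case: v => p l e.
have [k _ /place_inj hk] : pverts (face v' phi') (place (p, l)).
  by rewrite -e; apply: face_centre.
have [k' _ /place_inj hk'] : pverts (face v' phi') (place (p, l + 2)).
  rewrite -e (face_shift _ _ _ (-1)).
  by rewrite (_ : l + 2 = l - 2 * (-1)); [apply: face_centre|ring].
exact: site_eq_of_column hk hk'.
Qed.

(** A face has one vertex on each level; the one just below [v] gives the direction. *)
Lemma face_inj v phi phi' : face v phi = face v phi' -> phi = phi'.
Proof.
move=> e.
have [k _ /place_inj] : pverts (face v phi') (place (step v false phi)).
  by rewrite -e -(spiral_vertex1 b); exists 1.
move=> hk; have k1 : k = 1 by move: hk => [_]; lia.
by move: hk; rewrite k1 spiral_vertex1 => /step_inj[].
Qed.

End Embedding.

(** * Faces around an edge and around a vertex *)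

(** The direction of edge number [i] in the circuit around [v], where even numbers go up and odd
    ones down. The successor makes the circuit at the origin start at [px], like the octagon, when
    [b] is false. *)
Definition circuit_index (b : bool) (v : vertex) (i : nat) : 'Z_4 :=
  - chi b v.2 * (i./2.+1)%:R.

Lemma circuit_index_mod b v i : circuit_index b v (i %% 8) = circuit_index b v i.
Proof.
rewrite /circuit_index; congr (_ * _); apply: val_inj; rewrite /= !val_Zp_nat //.
lia.
Qed.

Lemma circuit_index_inj b v (i j : nat) : (i < 8)%N -> (j < 8)%N -> odd i = odd j ->
  circuit_index b v i = circuit_index b v j -> i = j.
Proof.
move=> i8 j8 oij /(congr1 (fun x => - chi b v.2 * x)).
rewrite /circuit_index !mulrA mulrNN chi_sqr !mul1r => /(congr1 val).
rewrite /= !val_Zp_nat //; lia.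
Qed.

Lemma circuit_index_surj b v s j :
  exists2 i : nat, (i < 8)%N & odd i = ~~ s /\ circuit_index b v i = j.
Proof.
(* The solution of [- chi b v.2 * (x + 1) = j], since [chi] squares to 1. *)
pose x : 'Z_4 := - chi b v.2 * j - 1.
have x4 : (x < 4)%N by apply: ltn_ord.
exists ((~~ s) + x.*2)%N; first by case: s; lia.
rewrite oddD odd_double addbF oddb; split=> //.
rewrite /circuit_index half_bit_double -natr1 natr_Zp subrK mulrA mulrNN.
by rewrite chi_sqr mul1r.
Qed.

Section Local.
Variables (R : realType) (a c : R).
Hypotheses (ha : 0 < a) (hc : 0 < c).
Variable b : bool.
Local Notation place := (place a c).
Local Notation link := (link a c).
Local Notation face := (face a c b).
Local Notation axial_face := (axial_face a c b).

Definition spiralhedron : prepolyhedron R :=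
  Prepolyhedron (range place)
    [set e | exists v s j, e = link v s j]
    [set f | exists v phi, f = face v phi].

Lemma axial_face_face v s j : faces spiralhedron (axial_face v s j).
Proof. by exists v, (if s then j + chi b v.2 else j). Qed.

Lemma axial_face_neq v s j v' s' j' :
  v.1 <> v'.1 -> axial_face v s j <> axial_face v' s' j'.
Proof. by move=> ne /(face_shared_site ha hc). Qed.

(** By [face_edge], a face through an edge is the axial face of one of the two labels of that edge;
    these two faces have different axes. *)
Lemma two_faces : edges_in_two_faces spiralhedron.
Proof.
move=> _ e [v0 [phi0 ->]] /face_edge[v [s [j [-> ->]]]].
exists (axial_face (step v s j) (~~ s) (back v.1 j)); split.
  split; first exact: axial_face_face.
    by apply: axial_face_neq => /nbr_neq.
  by rewrite -link_back; apply: axial_face_link.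
move=> _ [[v1 [phi1 ->]]] ne /face_edge[v' [s' [j' [e' fE]]]].
rewrite fE in ne *.
have [[ev es ej]|[ev ev']] := link_inj ha hc e'.
  by case: ne; rewrite ev es ej.
move: e'; rewrite -link_back -ev => /(link_inj ha hc)[[_ -> ->] //|].
by move=> [/esym/step_neq].
Qed.

(* The face around the site [nbr v.1 j] that passes through v. *)
Definition flank v j := axial_face (step v true j) false (back v.1 j).


(** The neighbours of [v] over [nbr v.1 j], one level above and one below, are successive axial
    vertices of the same spiral. *)
Lemma flankE v j : flank v j = axial_face (step v false j) true (back v.1 j).
Proof.
rewrite /flank /axial_face /step /= (face_shift _ _ _ _ _ _ 1) chiB1.
have -> : v.2 + 1 - 2 * 1 = v.2 - 1 by ring.
by rewrite chiD1 mulr1.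
Qed.

Lemma flank_link v s j : pedges (flank v j) (link v s j).
Proof.
rewrite -link_back; case: s; first exact: axial_face_link.
by rewrite flankE; apply: axial_face_link.
Qed.

(** Vertices with an even number lie on the axis; at those with an odd number the face is a
    flank. *)
Lemma face_vertex v phi w : pverts (face v phi) w ->
  exists v' j, w = place v' /\ (face v phi = face v' j \/ face v phi = flank v' j).
Proof.
case: v => p l [k _ <-]; have [m [->|->]] := int_parity k.
  rewrite spiral_vertex_even; exists (p, l - 2 * m), (phi + chi b l * m%:~R).
  by split=> //; left; apply: face_shift.
rewrite spiral_vertex_odd /=; set psi := phi + _.
exists (nbr p psi, l - (2 * m + 1)), (back p psi); split=> //; right.
rewrite /flank /step /axial_face /= nbr_back (face_shift _ _ _ _ _ _ m).
rewrite -/psi.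
have -> : l - (2 * m + 1) + 1 = l - 2 * m by ring.
(* Going back twice restores the direction [psi], by injectivity of [nbr]. *)
have := nbr_back (nbr p psi) (back p psi).
by rewrite [X in nbr X _]nbr_back => /nbr_inj ->.
Qed.

(** Numbered so that face [i] contains the edges [i] and [i.+1] at [v]: a flank joins the two edges
    towards one site, and a face around [v] joins an edge going down to one going up in the next
    direction of the circuit. *)
Definition circuit_face v i :=
  if odd i then face v (circuit_index b v i) else flank v (circuit_index b v i).

Definition circuit_link v i := link v (~~ odd i) (circuit_index b v i).

Lemma circuit_face_face v i : faces spiralhedron (circuit_face v i).
Proof.
rewrite /circuit_face; case: ifP => _; first by exists v, (circuit_index b v i).
exact: axial_face_face.
Qed.

Lemma circuit_face_link v i : pedges (circuit_face v i) (circuit_link v i).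
Proof.
rewrite /circuit_face /circuit_link; case: (odd i); last exact: flank_link.
exact: (axial_face_link _ _ _ _ false).
Qed.

Lemma circuit_face_linkS v i : pedges (circuit_face v i) (circuit_link v i.+1).
Proof.
rewrite /circuit_face /circuit_link /= negbK; case: ifP => oi; last first.
  by rewrite /circuit_index /= uphalf_half oi; apply: flank_link.
have -> : circuit_index b v i = circuit_index b v i.+1 + chi b v.2.
  by rewrite /circuit_index /= uphalf_half oi add1n -[in RHS]natr1; ring.
exact: (axial_face_link _ _ _ _ true).
Qed.

Lemma circuit_link_mod v i : circuit_link v (i %% 8) = circuit_link v i.
Proof.
by rewrite /circuit_link circuit_index_mod odd_mod.
Qed.

Lemma circuit_link_surj v s j :
  exists2 i : nat, (i < 8)%N & link v s j = circuit_link v i.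
Proof.
have [i i8 [oi <-]] := circuit_index_surj b v s j.
by exists i; rewrite // /circuit_link oi negbK.
Qed.

Lemma circuit_face_inj v (i j : nat) : (i < 8)%N -> (j < 8)%N ->
  circuit_face v i = circuit_face v j -> i = j.
Proof.
move=> i8 j8; rewrite /circuit_face.
case oi: (odd i); case oj: (odd j).
- by move/(face_inj ha hc); apply: circuit_index_inj => //; rewrite oi.
- by move/(face_shared_site ha hc) => /= /esym/nbr_neq.
- by move/(face_shared_site ha hc) => /= /nbr_neq.
- move/(face_shared_site ha hc) => /= /nbr_inj.
  by apply: circuit_index_inj => //; rewrite oi.
Qed.

Lemma single_circuit v : single_circuit_at spiralhedron (place v).
Proof.
exists 8%N, (fun i : 'I_8 => circuit_face v i); split=> //.
- by move=> i j /circuit_face_inj => /(_ (ltn_ord i) (ltn_ord j)) /val_inj.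
- apply/seteqP; split=> [_ [i _ <-]|_ [[v' [phi ->]] /face_vertex]].
    split; first exact: circuit_face_face.
    rewrite /circuit_face; case: ifP => _; first exact: face_centre.
    rewrite /flank /axial_face; exists 1 => //.
    by rewrite /spiral_vertex /= mulr0 addr0 nbr_back addrK; case: v.
  move=> [w [j [/(place_inj ha hc) <- eE]]].
  have [[i i8 [oi ej]] [k k8 [ok ek]]] := (circuit_index_surj b v false j,
    circuit_index_surj b v true j).
  case: eE => ->; [exists (Ordinal i8) | exists (Ordinal k8)] => //=.
    by rewrite /circuit_face oi ej.
  by rewrite /circuit_face ok ek.
- move=> i; exists (circuit_link v i.+1); split.
  + exact: circuit_face_linkS.
  (* [ordS] reduces modulo 8, and so may the number of the edge be. *)
  + by rewrite /= -circuit_link_mod; apply: circuit_face_link.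
  + exists (place (step v (~~ odd i.+1) (circuit_index b v i.+1))); split=> //.
    by move/(place_inj ha hc)/step_neq.
Qed.

(** Among the distinct faces around [v] in the directions 0, 1 and 2, at least two differ from
    [f]. *)
Lemma three_faces : vertices_in_three_faces spiralhedron.
Proof.
move=> f w Ff fw.
have [v ev] : exists v, w = place v.
  by case: Ff fw => [v0 [phi ->]] /face_vertex[v [_ [-> _]]]; exists v.
have cf phi : faces spiralhedron (face v phi) /\ pverts (face v phi) w.
  by split; [exists v, phi|rewrite ev; apply: face_centre].
have neq phi psi : phi != psi -> face v phi <> face v psi.
  by move=> /eqP ne /(face_inj ha hc).
have [e0|n0] := pselect (face v 0 = f).
  by exists (face v 1), (face v 2); split=> //; rewrite -?e0; apply: neq.
have [e1|n1] := pselect (face v 1 = f).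
  by exists (face v 0), (face v 2); split=> //; rewrite -?e1; apply: neq.
by exists (face v 0), (face v 1); split=> //; apply: neq.
Qed.

End Local.

(** * Connectedness and discreteness *)

(** For negative [k] one walks from [g k] up to [g 0] and uses symmetry. *)
Lemma equiv_int_line (T : Type) (r : T -> T -> Prop) (g : int -> T) :
  (forall x, r x x) -> (forall x y, r x y -> r y x) ->
  (forall x y z, r x y -> r y z -> r x z) ->
  (forall k, r (g k) (g (k + 1))) -> forall k, r (g 0) (g k).
Proof.
move=> rr rs rt gS; suff gn k (n : nat) : r (g k) (g (k + n%:Z)).
  case=> n; first by have := gn 0 n; rewrite add0r.
  by apply: rs; have := gn (Negz n) n.+1; rewrite NegzE addNr.
elim: n => [|n IH]; first by rewrite addr0.
by apply: rt IH _; rewrite -addn1 PoszD addrA.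
Qed.

Section Connected.
Variables (R : realType) (a c : R) (b : bool).
Local Notation place := (place a c).
Local Notation link := (link a c).
Local Notation P := (spiralhedron a c b).

Definition share_face (e e' : set 'rV[R]_3) :=
  exists f, [/\ faces P f, pedges f e & pedges f e'].

Local Notation conn := (clos_refl_sym_trans _ share_face).

Lemma share_face_sym e e' : share_face e e' -> share_face e' e.
Proof. by move=> [f [? ? ?]]; exists f. Qed.

Lemma face_link f e : faces P f -> pedges f e -> edges P e.
Proof.
by move=> [v [phi ->]] /face_edge[v' [s [j [-> _]]]]; exists v', s, j.
Qed.

Lemma chain_of_conn e e' : conn e e' -> edges P e ->
  exists (n : nat) (es : nat -> set 'rV[R]_3) (fs : nat -> polygon R),
    [/\ es 0%N = e, es n = e', forall i, (i <= n)%N -> edges P (es i) &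
        forall i, (i < n)%N ->
          [/\ faces P (fs i), pedges (fs i) (es i) &
              pedges (fs i) (es i.+1)]].
Proof.
move=> /clos_rst_rstn1_iff + He; elim=> [|x y xy _ [n [es [fs [e0 en He' Hf]]]]].
  (* The chain of length 0 uses no face, so the polygon is a mere filler. *)
  by exists 0%N, (fun=> e), (fun=> Polygon set0 set0); split.
have [f [Ff fx fy]] : share_face x y by case: xy => // /share_face_sym.
exists n.+1, (fun i => if (i <= n)%N then es i else y),
  (fun i => if (i < n)%N then fs i else f); split=> //.
- by rewrite ltnn.
- move=> i _; case: ifP => [/He' //|_]; exact: face_link Ff fy.
- move=> i; rewrite ltnS => lin; rewrite lin.
  case: ltnP => [/Hf //|ni].
  have -> : i = n by apply/eqP; rewrite eqn_leq lin ni.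
  by rewrite en.
Qed.

Definition vconn v w := forall s j s' j', conn (link v s j) (link w s' j').

(** Successive edges of the circuit at [v] share a face, so all edges at [v] are connected. *)
Lemma vconn_refl v : vconn v v.
Proof.
suff c0 i : conn (circuit_link a c b v 0) (circuit_link a c b v i).
  move=> s j s' j'.
  have [i _ ->] := circuit_link_surj a c b v s j.
  have [i' _ ->] := circuit_link_surj a c b v s' j'.
  by apply: rst_trans (c0 i'); apply: rst_sym.
elim: i => [|i]; first exact: rst_refl.
move=> IH; apply: rst_trans IH _; apply: rst_step.
exists (circuit_face a c b v i); split; first exact: circuit_face_face.
  exact: circuit_face_link.
exact: circuit_face_linkS.
Qed.

Lemma vconn_sym v w : vconn v w -> vconn w v.
Proof. by move=> vw s j s' j'; apply: rst_sym. Qed.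

Lemma vconn_trans v w x : vconn v w -> vconn w x -> vconn v x.
Proof.
by move=> vw wx s j s' j'; apply: rst_trans (vw _ _ true 0) (wx _ _ _ _).
Qed.

Lemma vconn_step v s j : vconn v (step v s j).
Proof.
move=> s1 j1 s2 j2; apply: rst_trans (vconn_refl v s1 j1 s j) _.
by rewrite -link_back; apply: vconn_refl.
Qed.

Lemma vconn_steps v s j w : w = step v s j -> vconn v w.
Proof. by move=> ->; apply: vconn_step. Qed.

Lemma vconn_int (g : int -> vertex) :
  (forall k, vconn (g k) (g (k + 1))) -> forall k, vconn (g 0) (g k).
Proof. exact: equiv_int_line vconn_refl vconn_sym vconn_trans. Qed.

Lemma vconn_level2 p l : vconn (p, l) (p, l + 2).
Proof.
apply: vconn_trans (vconn_step _ true 0) _.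
apply: (@vconn_steps _ true (back p 0)).
by rewrite /step /= nbr_back; congr pair; ring.
Qed.

(* Going up around a triangle of sites changes the level by 3, while going up
   and back changes it by 2. *)
Lemma vconn_level m n l : vconn ((KA, m, n), 0) ((KA, m, n), l).
Proof.
pose g k : vertex := ((KA, m, n), k); apply: (vconn_int (g := g)) => k.
apply: (@vconn_trans _ (g (k + 3))); last first.
  by apply: vconn_sym; rewrite (_ : k + 3 = k + 1 + 2); [exact: vconn_level2|ring].
apply: vconn_trans (vconn_step _ true 2) _.
apply: vconn_trans (vconn_step _ true 0) _.
apply: (@vconn_steps _ true 3); rewrite /g /step /=.
by congr (_, _, _, _); ring.
Qed.

Lemma vconn_origin v : vconn ((KA, 0, 0), 0) v.
Proof.
suff KAc m n l : vconn ((KA, 0, 0), 0) ((KA, m, n), l).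
  case: v => [[[[] m] n] l] //.
    exact: (vconn_trans (KAc _ _ _) (vconn_sym (vconn_step (KB, m, n, l) true 3))).
  exact: (vconn_trans (KAc _ _ _) (vconn_sym (vconn_step (KC, m, n, l) true 3))).
apply: vconn_trans (vconn_level m n l).
apply: (@vconn_trans _ ((KA, m, 0), 0)).
  pose g k : vertex := ((KA, k, 0), 0); apply: (vconn_int (g := g)) => k.
  (* Three rising steps lead to the next site of the row, so the walk starts at level -3. *)
  apply: vconn_trans (vconn_level k 0 (-3)) _.
  apply: vconn_trans (vconn_step _ true 2) _.
  apply: vconn_trans (vconn_step _ true 2) _.
  exact: (@vconn_steps _ true 3).
pose g k : vertex := ((KA, m, k), 0); apply: (vconn_int (g := g)) => k.
apply: vconn_trans (vconn_step _ true 2) _.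
exact: (@vconn_steps _ false 1).
Qed.

Lemma chain_connected : edge_chain_connected P.
Proof.
move=> _ _ [v [s [j ->]]] [v' [s' [j' ->]]].
apply: chain_of_conn; last by exists v, s, j.
by apply: (vconn_trans (vconn_sym (vconn_origin v)) (vconn_origin v')).
Qed.

End Connected.

Lemma finite_int_interval (N : nat) : finite_set [set k : int | `|k| <= N%:Z].
Proof.
apply: (@sub_finite_set _ _ ((fun n : nat => n%:Z) @` `I_N.+1
                             `|` (fun n : nat => - n%:Z) @` `I_N.+1)).
  move=> k /= kN; case: (lerP 0 k) => k0; [left|right]; exists (`|k|%N) => /=; lia.
by rewrite finite_setU; split; apply/finite_image/finite_II.
Qed.

Lemma int_bound (R : realType) (d M : R) : 0 < d ->
  exists N : nat, forall k : int, `|k%:~R * d| <= M -> `|k| <= N%:Z.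
Proof.
move=> d0; exists (Num.bound (`|M| / d)) => k.
rewrite normrM (gtr0_norm d0) -ler_pdivlMr // => kM.
rewrite -(@ler_int R) -[in leRHS]pmulrn intr_norm.
apply: le_trans kM (le_trans _ (ltW (archi_boundP _))).
  by rewrite ler_pM2r ?invr_gt0 // ler_norm.
by rewrite divr_ge0 // ltW.
Qed.

Lemma site_nbr_dist p j :
  `|site_x (nbr p j) - site_x p| <= 2 /\ `|site_y (nbr p j) - site_y p| <= 2.
Proof.
by case: p => [[[] m] n]; elim/Z4_cases: j => /=; split; lia.
Qed.

(* The coordinates of the endpoints of a segment differ by at most D, so an
   endpoint is within D of any point of the segment. *)
Lemma segment_coord_bound (R : realType) (p q x : 'rV[R]_3) i M D :
  segment p q x -> `|x 0 i| <= M -> `|q 0 i - p 0 i| <= D ->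
  `|p 0 i| <= M + D.
Proof.
move=> [s /= + <-]; rewrite in_itv /= => /andP[s0 s1]; rewrite !mxE => hM hD.
have -> : p 0 i = ((1 - s) * p 0 i + s * q 0 i) - s * (q 0 i - p 0 i) by ring.
apply: le_trans (ler_normB _ _) _; apply: lerD => //.
rewrite normrM; apply: le_trans hD; rewrite ger0_norm //.
by rewrite ler_piMl.
Qed.

(** * Local finiteness of edges and faces *)

Section Discrete.
Variables (R : realType) (a c : R).
Hypotheses (ha : 0 < a) (hc : 0 < c).
Local Notation place := (place a c).
Local Notation link := (link a c).
Local Notation sqrt3 := (Num.sqrt (3 : R)).

(** [K] is bounded and an edge spans at most two units in each coordinate, so the integer
    coordinates of [v] are bounded; they determine [v]. *)
Lemma finite_links (K : set 'rV[R]_3) : compact K ->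
  finite_set [set v | exists s j, link v s j `&` K !=set0].
Proof.
(* Only numbers strictly beyond [M] are known to bound [K], hence [M + 1]. *)
move=> /compact_bounded[M [_ /(_ (M + 1))]].
rewrite ltrDl ltr01 => /(_ isT) KM.
have {}KM x i : K x -> `|x 0 i| <= M + 1.
  move=> /KM; apply: le_trans; rewrite /Num.norm /= mx_normrE.
  exact: (@le_bigmax _ _ _ 0 (fun ij => `|x ij.1 ij.2|) (0, i)).
have s3 : 0 < sqrt3 by rewrite sqrtr_gt0.
have dx : 0 < a / 2 by rewrite divr_gt0.
have dy : 0 < sqrt3 * a / 2 by rewrite divr_gt0 // mulr_gt0.
have [Nx hx] := int_bound (M + 1 + 2 * (a / 2)) dx.
have [Ny hy] := int_bound (M + 1 + 2 * (sqrt3 * a / 2)) dy.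
have [Nz hz] := int_bound (M + 1 + 2 * c) hc.
pose B := ([set k : int | `|k| <= Nx%:Z] `*` [set k : int | `|k| <= Ny%:Z])
  `*` [set k : int | `|k| <= Nz%:Z].
apply: (@sub_finite_set _ _ ((fun v => (site_x v.1, site_y v.1, v.2)) @^-1` B)).
  move=> v [s [j [x [vx Kx]]]].
  have [ex ey] := site_nbr_dist v.1 j.
  have dist (k k' : int) (d : R) : 0 < d -> `|k' - k| <= 2 ->
      `|k'%:~R * d - k%:~R * d| <= 2 * d.
    move=> d0 kk'; rewrite -mulrBl normrM (gtr0_norm d0) ler_pM2r //.
    by rewrite -intrB -intr_norm (ler_int _ _ 2).
  split; [split|] => /=.
  - apply: hx; have := segment_coord_bound vx (KM _ 0 Kx).
    by rewrite !mxE /=; apply; apply: dist.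
  - apply: hy; have := segment_coord_bound vx (KM _ 1 Kx).
    by rewrite !mxE /=; apply; apply: dist.
  - apply: hz; have := segment_coord_bound vx (KM _ 2 Kx).
    rewrite !mxE /=; apply; apply: dist => //.
    by case: s {vx} => /=; lia.
apply: finite_preimage; last by do !apply: finite_setX; apply: finite_int_interval.
move=> [p l] [p' l'] _ _ /= [ex ey ->].
by rewrite (site_xy_inj ex ey).
Qed.

Variable b : bool.
Local Notation P := (spiralhedron a c b).

Lemma finite_edges_meet (K : set 'rV[R]_3) : compact K ->
  finite_set [set e | edges P e /\ e `&` K !=set0].
Proof.
move=> /finite_links fK.
apply: (@sub_finite_set _ _ ((fun vsj : vertex * (bool * 'Z_4) =>
    link vsj.1 vsj.2.1 vsj.2.2) @` ([set v | exists s j,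
    link v s j `&` K !=set0] `*` setT))).
  move=> _ [[v [s [j ->]]] vK]; exists (v, (s, j)) => //.
  by split=> //; exists s, j.
by apply: finite_image; apply: finite_setX => //; exact: finite_finset.
Qed.

(** A face that meets [K] does so in one of its edges, and it is the axial face of a label of that
    edge. *)
Lemma faces_discrete : finitely_many_faces_meet P.
Proof.
move=> K /finite_links fK.
apply: (@sub_finite_set _ _ ((fun vsj : vertex * (bool * 'Z_4) =>
    axial_face a c b vsj.1 vsj.2.1 vsj.2.2) @` ([set v | exists s j,
    link v s j `&` K !=set0] `*` setT))).
  move=> _ [[v [phi ->]] [e /face_edge[v' [s [j [-> ->]]]] vK]].
  by exists (v', (s, j)) => //; split=> //; exists s, j.
by apply: finite_image; apply: finite_setX => //; exact: finite_finset.
Qed.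

Lemma face_is_polygon v phi : is_polygon (face a c b v phi).
Proof.
right; exists (fun k => place (spiral_vertex b v phi k)); split=> //.
  by move=> k k' /(place_inj ha hc)/spiral_vertex_inj.
move=> K cK; apply: sub_finite_set (finite_edges_meet cK) => e [fe eK]; split=> //.
by apply: face_link fe; exists v, phi.
Qed.

Lemma spiralhedron_polyhedron : is_polyhedron P.
Proof.
split.
- move=> _ [v [s [j ->]]]; exists (place v), (place (step v s j)).
  split=> //; [by exists v|by exists (step v s j)|].
  by move=> /(place_inj ha hc)/esym/step_neq.
- move=> _ [v [phi ->]]; split; first exact: face_is_polygon.
    by move=> w /face_vertex[v' [_ [-> _]]]; exists v'.
  by move=> e; apply: face_link; exists v, phi.
- exact: two_faces.
- exact: three_faces.
- by move=> _ [v _ <-]; apply: single_circuit.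
- exact: chain_connected.
- exact: faces_discrete.
Qed.

End Discrete.

(** * Words in the mirrors *)

Inductive mirror := M0 | M1 | M2 | M3 | M4.

(** The reflections in lattice coordinates; [mirror_place] checks the table. *)
Definition site_mirror (i : mirror) (p : site) : site :=
  let: (t, m, n) := p in
  match i, t with
  | M1, KA => (KA, m + n, - n)
  | M1, KB => (KC, m + n, - n - 1)
  | M1, KC => (KB, m + n + 1, - n - 1)
  | M2, KA => (KA, - m - n, n)
  | M2, KB => (KC, - m - n - 1, n)
  | M2, KC => (KB, - m - n - 1, n)
  | M3, KA => (KB, m, - m - n)
  | M3, KB => (KA, m, - m - n)
  | M3, KC => (KC, m, - m - n - 1)
  | _, _ => p
  end.

Definition mirror_vertex i (v : vertex) : vertex :=
  match i with
  | M0 => (v.1, - v.2)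
  | M4 => (v.1, 1 - v.2)
  | _ => (site_mirror i v.1, v.2)
  end.

Definition vertical i := match i with M0 | M4 => false | _ => true end.

(* [gamma4] reverses orientation and exchanges even and odd levels, so it
   preserves the alternating chirality of the spirals. *)
Definition flips_chirality i := match i with M4 => false | _ => true end.

(** A plane reflection reverses the cyclic order of the neighbours, hence the form [t - j]. *)
Lemma site_mirror_nbr i p : vertical i ->
  exists t, forall j, site_mirror i (nbr p j) = nbr (site_mirror i p) (t - j).
Proof.
case: p => [[t m] n]; case: i t => [] // [] // _;
  [exists 1|exists 0|exists 0|exists 3|exists 2|exists 2|exists 1|exists 1|exists 1];
  by elim/Z4_cases => /=; congr (_, _, _); lia.
Qed.

Lemma mirror_step i v s j : exists s' j',
  mirror_vertex i (step v s j) = step (mirror_vertex i v) s' j'.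
Proof.
have [vi|nvi] := boolP (vertical i).
  have [t e] := site_mirror_nbr v.1 vi; exists s, (t - j).
  by case: i vi e => // _ e; rewrite /step /= e.
exists (~~ s), j; case: i nvi => // _; rewrite /step /=; congr pair;
  by case: s => /=; ring.
Qed.

(** The horizontal mirror at level [t / 2] turns descent into ascent. Read backwards, the image
    descends and turns the other way, and the image of vertex number -1 becomes vertex number 1. *)
Lemma spiral_vertex_flip b b' t v phi k : chi b' (t - v.2) = - chi b v.2 ->
  ((spiral_vertex b v phi k).1, t - (spiral_vertex b v phi k).2) =
  spiral_vertex b' (v.1, t - v.2) (phi - chi b v.2) (- k).
Proof.
move=> e; have [m [->|->]] := int_parity k.
  by rewrite -mulrN !spiral_vertex_even /=; congr pair; ring.
have -> : - (2 * m + 1) = 2 * (- m - 1) + 1 by ring.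
rewrite !spiral_vertex_odd /= e; congr (nbr _ _, _); last by ring.
by rewrite rmorphB rmorphN /=; ring.
Qed.

(** The sign [sg] is 1 for vertical mirrors and -1 for horizontal ones, whose images are read
    backwards. *)
Lemma spiral_vertex_mirror i b v phi : exists phi' sg, (sg = 1 \/ sg = -1) /\
  forall k, mirror_vertex i (spiral_vertex b v phi k) =
    spiral_vertex (b (+) flips_chirality i) (mirror_vertex i v) phi' (sg * k).
Proof.
have [vi|nvi] := boolP (vertical i).
  have [t e] := site_mirror_nbr v.1 vi; exists (t - phi), 1; split; first by left.
  have -> : flips_chirality i = true by case: i vi {e}.
  have mE w : mirror_vertex i w = (site_mirror i w.1, w.2) by case: i vi {e}.
  move=> k; rewrite mul1r addbT !mE; have [m [->|->]] := int_parity k.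
    by rewrite !spiral_vertex_even.
  by rewrite !spiral_vertex_odd /= chiNb mulNr -addrA -opprD -e.
exists (phi - chi b v.2), (-1); split=> [|k]; first by right.
rewrite mulN1r; case: i nvi => // _; rewrite /mirror_vertex.
  rewrite -[- v.2]add0r -(@spiral_vertex_flip b) ?add0r //.
  by rewrite addbT chiN chiNb.
rewrite addbF -(@spiral_vertex_flip b) //.
by rewrite -chiN opprB chiB1.
Qed.

(** Group elements are represented by words in the mirrors; as mirrors are involutions, the reversed
    word is the inverse. *)
Definition word_vertex (w : seq mirror) v := foldr mirror_vertex v w.

Definition word_flips (w : seq mirror) :=
  foldr (fun i s => s (+) flips_chirality i) false w.

Lemma word_vertex_cat w w' v :
  word_vertex (w ++ w') v = word_vertex w (word_vertex w' v).
Proof. exact: foldr_cat. Qed.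

Lemma word_flips_cat w w' : word_flips (w ++ w') = word_flips w' (+) word_flips w.
Proof. by elim: w => [|i w /= ->]; rewrite ?addbF // addbA. Qed.

Lemma word_flips_rev w : word_flips (rev w) = word_flips w.
Proof.
elim: w => // i w IH; rewrite rev_cons -cats1 word_flips_cat IH /=.
by rewrite addbC.
Qed.

Lemma mirror_vertexK i : involutive (mirror_vertex i).
Proof.
case: i => -[[[[] m] n] l]; rewrite /mirror_vertex /=; congr (_, _, _, _); ring.
Qed.

Lemma word_vertexK w : cancel (word_vertex w) (word_vertex (rev w)).
Proof.
elim: w => // i w IH v; rewrite rev_cons -cats1 word_vertex_cat /=.
by rewrite mirror_vertexK.
Qed.

Lemma word_step w v s j : exists s' j',
  word_vertex w (step v s j) = step (word_vertex w v) s' j'.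
Proof.
elim: w => [|i w [s' [j' /= ->]]]; first by exists s, j.
exact: mirror_step.
Qed.

Definition origin : vertex := ((KA, 0, 0), 0).

Definition orbit_equiv v v' := exists w, word_vertex w v = v'.

Lemma orbit_equiv_refl v : orbit_equiv v v.
Proof. by exists [::]. Qed.

Lemma orbit_equiv_sym v v' : orbit_equiv v v' -> orbit_equiv v' v.
Proof. by move=> [w <-]; exists (rev w); apply: word_vertexK. Qed.

Lemma orbit_equiv_trans v v' v'' :
  orbit_equiv v v' -> orbit_equiv v' v'' -> orbit_equiv v v''.
Proof.
by move=> [w <-] [w' <-]; exists (w' ++ w); apply: word_vertex_cat.
Qed.

Lemma orbit_equiv_line (g : int -> vertex) :
  (forall k, orbit_equiv (g k) (g (k + 1))) -> forall k, orbit_equiv (g 0) (g k).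
Proof.
exact: equiv_int_line orbit_equiv_refl orbit_equiv_sym orbit_equiv_trans.
Qed.

Lemma orbit_equiv_level p l : orbit_equiv (p, 0) (p, l).
Proof.
apply: (orbit_equiv_line (g := fun l => (p, l))) => k.
by exists [:: M4; M0]; rewrite /=; congr pair; ring.
Qed.

(* The words below are translations: products of reflections in two parallel
   mirrors. *)
Lemma orbit_equiv_row m n l : orbit_equiv ((KA, m, n), l) ((KA, m, n + 1), l).
Proof.
exists [:: M3; M1; M2; M3; M1; M2] => /=; congr (_, _, _, _); ring.
Qed.

Lemma orbit_equiv_diag m n l :
  orbit_equiv ((KA, m, n), l) ((KA, m - 1, n + 1), l).
Proof.
exists [:: M2; M3; M1; M2; M3; M1] => /=; congr (_, _, _, _); ring.
Qed.

(** Translations reach every site of kind [KA], [M3] leads from there to kind [KB], and [M2] from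
    [KB] to [KC]. *)
Lemma orbit_equiv_origin v : orbit_equiv origin v.
Proof.
suff KAe m n l : orbit_equiv origin ((KA, m, n), l).
  have KBe m n l : orbit_equiv origin ((KB, m, n), l).
    apply: orbit_equiv_trans (KAe m (- m - n) l) _.
    by exists [:: M3] => /=; congr (_, _, _, _); ring.
  case: v => [[[[] m] n] l] //.
  apply: orbit_equiv_trans (KBe (- m - n - 1) n l) _.
  by exists [:: M2] => /=; congr (_, _, _, _); ring.
apply: orbit_equiv_trans (orbit_equiv_level _ l).
apply: (@orbit_equiv_trans _ ((KA, m, 0), 0)).
  apply: (orbit_equiv_line (g := fun m => ((KA, m, 0), 0))) => k.
  (* The sites [(KA, k, 0)] and [(KA, k + 1, 0)] are both equivalent to [(KA, k, 1)]. *)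
  apply: orbit_equiv_sym; apply: orbit_equiv_trans (orbit_equiv_diag _ _ _) _.
  by rewrite addrK; apply: orbit_equiv_sym; apply: orbit_equiv_row.
by apply: (orbit_equiv_line (g := fun n => ((KA, m, n), 0))) => k; apply: orbit_equiv_row.
Qed.

(* [M1] fixes the origin, so w can be corrected to preserve chirality. *)
Lemma word_origin v : exists2 w, word_flips w = false & word_vertex w origin = v.
Proof.
have [w wv] := orbit_equiv_origin v.
case wf: (word_flips w); last by exists w.
by exists (w ++ [:: M1]); rewrite ?word_flips_cat ?wf // word_vertex_cat.
Qed.

(** [M0], [M1] and [M2] fix the origin, and their products permute its eight edges transitively. *)
Lemma word_step_origin s j : exists2 w,
  word_vertex w origin = origin &
  word_vertex w (step origin true 1) = step origin s j.
Proof.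
by case: s; elim/Z4_cases: j; [exists [:: M1]|exists [::]|exists [:: M2]
  |exists [:: M1; M2]|exists [:: M0; M1]|exists [:: M0]|exists [:: M0; M2]
  |exists [:: M0; M1; M2]].
Qed.

(** * The isometries given by words *)

Section Symmetries.
Variables (R : realType) (a c : R).
Local Notation sqrt3 := (Num.sqrt (3 : R)).
Local Notation place := (place a c).
Local Notation link := (link a c).
Local Notation face := (face a c).

Definition mirror_normal i : 'rV[R]_3 :=
  match i with
  | M0 | M4 => pt 0 0 1
  | M1 => pt 0 1 0
  | M2 => pt 1 0 0
  | M3 => pt 1 sqrt3 0
  end.

Definition mirror_offset i : R :=
  match i with M3 => a | M4 => c / 2 | _ => 0 end.

Definition mirror_map i := reflection (mirror_normal i) (mirror_offset i).

Lemma mirror_normal_neq0 i : dot (mirror_normal i) (mirror_normal i) != 0.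
Proof.
have s3 : sqrt3 * sqrt3 = 3 by rewrite -expr2 sqr_sqrtr.
case: i; rewrite dot_pt ?s3; apply: lt0r_neq0; lra.
Qed.

Lemma mirror_place i v : mirror_map i (place v) = place (mirror_vertex i v).
Proof.
case: v => p l; rewrite /mirror_map /mirror_normal /place.
case: i; rewrite reflection_pt /=.
- by rewrite intrN; congr pt; field.
- have [-> ->] : site_x (site_mirror M1 p) = site_x p /\
      site_y (site_mirror M1 p) = - site_y p by case: p => [[[] m] n] /=; lia.
  by rewrite intrN; congr pt; field.
- have [-> ->] : site_x (site_mirror M2 p) = - site_x p /\
      site_y (site_mirror M2 p) = site_y p by case: p => [[[] m] n] /=; lia.
  by rewrite intrN; congr pt; field.
(* The reflection in the oblique plane halves integer combinations, so the integer identities are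
   stated doubled. *)
- have [/(congr1 (@intmul R 1)) ex /(congr1 (@intmul R 1)) ey] :
      2 * site_x (site_mirror M3 p) = site_x p - 3 * site_y p + 2 /\
      2 * site_y (site_mirror M3 p) = - site_y p - site_x p + 2.
    by case: p => [[[] m] n] /=; lia.
  have s3 : sqrt3 * sqrt3 = 3 by rewrite -expr2 sqr_sqrtr.
  move: ex ey; rewrite !(intrD, intrM, intrN) => ex ey.
  have {ex} -> : (site_x (site_mirror M3 p))%:~R =
    ((site_x p)%:~R - 3 * (site_y p)%:~R + 2) / 2 :> R by lra.
  have {ey} -> : (site_y (site_mirror M3 p))%:~R =
    (- (site_y p)%:~R - (site_x p)%:~R + 2) / 2 :> R by lra.
  have -> : sqrt3 * ((site_y p)%:~R * (sqrt3 * a / 2)) =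
    sqrt3 * sqrt3 * (site_y p)%:~R * a / 2 by field.
  by rewrite s3; congr pt; field.
- by rewrite intrB; congr pt; field.
Qed.

Lemma mirror_affine i : affine (mirror_map i).
Proof. exact: reflection_affine. Qed.

Lemma mirror_mapK i : involutive (mirror_map i).
Proof. exact/reflectionK/mirror_normal_neq0. Qed.

Definition word_map (w : seq mirror) :=
  foldr (fun i g => mirror_map i \o g) id w.

Lemma word_map_cat w w' : word_map (w ++ w') = word_map w \o word_map w'.
Proof. by elim: w => //= i w ->. Qed.

Lemma word_mapK w : cancel (word_map w) (word_map (rev w)).
Proof.
elim: w => // i w IH x; rewrite rev_cons -cats1 word_map_cat /=.
by rewrite mirror_mapK IH.
Qed.

Lemma word_map_rev w : word_map w \o word_map (rev w) = id.
Proof. by apply/funext => x; rewrite -{1}(revK w) /= word_mapK. Qed.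

Lemma word_affine w : affine (word_map w).
Proof.
by elim: w => // i w IH s p q /=; rewrite IH mirror_affine.
Qed.

Lemma word_isometry w : euclidean_isometry (word_map w).
Proof.
elim: w => // i w IH p q /=; rewrite -(IH p q).
exact/reflection_isometry/mirror_normal_neq0.
Qed.

Lemma word_place w v : word_map w (place v) = place (word_vertex w v).
Proof. by elim: w => //= i w ->; apply: mirror_place. Qed.

Lemma word_link w v s j : exists s' j',
  word_map w @` link v s j = link (word_vertex w v) s' j'.
Proof.
have [s' [j' e]] := word_step w v s j; exists s', j'.
by rewrite /link affine_segment ?word_place ?e //; apply: word_affine.
Qed.

Lemma map_polygon_comp g h (f : polygon R) :
  map_polygon (g \o h) f = map_polygon g (map_polygon h f).
Proof.
rewrite /map_polygon /= image_comp; congr Polygon.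
by rewrite image_comp; apply: eq_imagel => e _ /=; rewrite image_comp.
Qed.

Lemma mirror_face i b v phi : exists phi',
  map_polygon (mirror_map i) (face b v phi) =
  face (b (+) flips_chirality i) (mirror_vertex i v) phi'.
Proof.
have [phi' [sg [sgE e]]] := spiral_vertex_mirror i b v phi; exists phi'.
rewrite /face map_infinite_polygon; last exact: mirror_affine.
under eq_fun do rewrite mirror_place e.
case: sgE => ->; first by under eq_fun do rewrite mul1r.
under eq_fun do rewrite mulN1r.
exact: (infinite_polygon_rev (fun k => place (spiral_vertex _ _ _ k))).
Qed.

Lemma word_face w b v phi : exists phi',
  map_polygon (word_map w) (face b v phi) =
  face (b (+) word_flips w) (word_vertex w v) phi'.
Proof.
elim: w => [|i w [phi' IH]] /=.
  exists phi; rewrite addbF /map_polygon image_id; congr Polygon.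
  by under eq_imagel do rewrite image_id; rewrite image_id.
have [phi'' e] := mirror_face i (b (+) word_flips w) (word_vertex w v) phi'.
rewrite map_polygon_comp IH e.
by exists phi''; rewrite addbA.
Qed.

Variable b : bool.
Local Notation P := (spiralhedron a c b).

Lemma word_symmetry w : word_flips w = false -> symmetry P (word_map w).
Proof.
(* A set stable under all chirality-preserving words is mapped onto itself, since the reversed word
   supplies preimages. *)
have invol (T : Type) (A : set T) (act : seq mirror -> T -> T) :
    (forall w x, act w (act (rev w) x) = x) ->
    (forall w x, word_flips w = false -> A x -> A (act w x)) ->
    word_flips w = false -> act w @` A = A.
  move=> actK stab wf; apply/seteqP; split=> [_ [x Ax <-]|x Ax].
    exact: stab.
  by exists (act (rev w) x); [apply: stab; rewrite ?word_flips_rev|apply: actK].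
move=> wf; split; first exact: word_isometry.
- apply: (invol _ _ word_map) => // [w' x|w' _ _ [v _ <-]].
    by rewrite -[LHS]/((word_map w' \o word_map (rev w')) x) word_map_rev.
  by rewrite word_place; exists (word_vertex w' v).
- apply: (invol _ _ (fun w e => word_map w @` e)) => // [w' e|w' _ _ [v [s [j ->]]]].
    by rewrite image_comp word_map_rev image_id.
  by have [s' [j' ->]] := word_link w' v s j; exists (word_vertex w' v), s', j'.
- apply: (invol _ _ (fun w => map_polygon (word_map w))) => // [w' f|w' _ w'f [v [phi ->]]].
    rewrite -map_polygon_comp word_map_rev /map_polygon image_id.
    case: f => pv pe /=; congr Polygon.
    by under eq_imagel do rewrite image_id; rewrite image_id.
  have [phi' ->] := word_face w' b v phi.
  by rewrite w'f addbF; exists (word_vertex w' v), phi'.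
Qed.

End Symmetries.

(** * Transitivity and identification *)

Section Transitivity.
Variables (R : realType) (a c : R).
Local Notation place := (place a c).
Local Notation link := (link a c).
Local Notation face := (face a c).
Local Notation word_map := (word_map a c).

Definition base_link := link origin true 1.

Lemma word_base_link w :
  word_map w @` base_link =
  segment (place (word_vertex w origin)) (place (word_vertex w (step origin true 1))).
Proof.
by rewrite affine_segment ?word_place //; apply: word_affine.
Qed.

(** [w1] carries the origin to [v], and [w2] fixes the origin and carries the base edge to the
    pullback of the target. If the product flips chirality, it is corrected by a flipping word that
    preserves the base edge. *)
Lemma link_orbit v s j :
  exists2 w, word_flips w = false & word_map w @` base_link = link v s j.
Proof.
have [w1 _ w1v] := word_origin v.
have [s' [j' e]] := word_step (rev w1) v s j.
have [w2 w2o w2e] := word_step_origin s' j'.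
have we : word_map (w1 ++ w2) @` base_link = link v s j.
  rewrite word_base_link !word_vertex_cat w2o w2e w1v; congr segment.
  congr place; move: e; rewrite -{2}w1v word_vertexK => <-.
  by rewrite -{1}(revK w1) word_vertexK.
case wf: (word_flips (w1 ++ w2)); last by exists (w1 ++ w2).
(* This word exchanges the endpoints of [base_link]. *)
exists ((w1 ++ w2) ++ [:: M2; M3; M2; M4]); first by rewrite word_flips_cat wf.
rewrite -we !word_base_link !(word_vertex_cat (w1 ++ w2)) segmentC.
by congr segment.
Qed.

Variable b : bool.
Local Notation P := (spiralhedron a c b).

(** The word is the upward translation by two levels, which moves a spiral along its axis by one
    axial vertex and so changes its direction at [v] by one turn. *)
Lemma translate_face v phi :
  map_polygon (word_map [:: M4; M0; M4; M0]) (face b v phi) =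
  face b v (phi + chi b v.2).
Proof.
rewrite /face map_infinite_polygon; last exact: word_affine.
rewrite -[RHS](infinite_polygon_shift _ (2 * (-1))); congr infinite_polygon.
apply/funext => k; rewrite word_place; congr place; case: v => p l.
rewrite spiral_vertex_shift /=.
have -> : phi + chi b l + chi b l * (-1)%:~R = phi by ring.
rewrite (_ : l - -2 = l + 2 * 1); last by ring.
rewrite /spiral_vertex /= chi_addn2; congr pair; ring.
Qed.

(** A word moves the axis to that of the target, and repeated translation by two levels then adjusts
    the direction. *)
Lemma face_orbit v phi :
  exists2 w, word_flips w = false &
    map_polygon (word_map w) (face b origin 0) = face b v phi.
Proof.
have [w wf wv] := word_origin v.
have [phi0 e] := word_face a c w b origin 0.
rewrite wf addbF wv in e.
suff face_n (n : nat) : exists2 w, word_flips w = false &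
    map_polygon (word_map w) (face b origin 0) =
    face b v (phi0 + chi b v.2 * n%:R).
  pose x : 'Z_4 := chi b v.2 * (phi - phi0).
  have [w' w'f w'e] := face_n x.
  by exists w'; rewrite // w'e natr_Zp /x mulrA chi_sqr mul1r subrKC.
elim: n => [|n [w1 w1f w1e]]; first by exists w; rewrite // mulr0 addr0.
exists ([:: M4; M0; M4; M0] ++ w1); first by rewrite word_flips_cat w1f.
rewrite word_map_cat map_polygon_comp w1e translate_face.
by rewrite -natr1 mulrDr mulr1 addrA.
Qed.

Lemma symmetry_between w w' : word_flips w = false -> word_flips w' = false ->
  symmetry P (word_map (w' ++ rev w)).
Proof.
move=> wf w'f; apply: word_symmetry.
by rewrite word_flips_cat word_flips_rev wf w'f.
Qed.

(** Two objects of the same sort are images of a base object under chirality-preserving words [w]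
    and [w'], and [w' ++ rev w] carries the first to the second. *)
Lemma spiralhedron_fully_transitive : fully_transitive P.
Proof.
split.
- move=> _ _ [v _ <-] [v' _ <-].
  have [[w wf wv] [w' w'f w'v]] := (word_origin v, word_origin v').
  exists (word_map (w' ++ rev w)); first exact: symmetry_between.
  by rewrite word_place word_vertex_cat -{1}wv word_vertexK w'v.
- move=> _ _ [v [s [j ->]]] [v' [s' [j' ->]]].
  have [[w wf <-] [w' w'f <-]] := (link_orbit v s j, link_orbit v' s' j').
  exists (word_map (w' ++ rev w)); first exact: symmetry_between.
  rewrite image_comp word_map_cat -compA.
  by rewrite -{2}(revK w) word_map_rev.
- move=> _ _ [v [phi ->]] [v' [phi' ->]].
  have [[w wf <-] [w' w'f <-]] := (face_orbit v phi, face_orbit v' phi').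
  exists (word_map (w' ++ rev w)); first exact: symmetry_between.
  rewrite -map_polygon_comp word_map_cat -compA.
  by rewrite -{2}(revK w) word_map_rev.
Qed.

Hypotheses (ha : 0 < a) (hc : 0 < c).

Lemma adjacentE v :
  [set w | Defs.adjacent P (place v) w] =
  [set w | exists s j, w = place (step v s j)].
Proof.
apply/seteqP; split=> w.
  move=> [_ [w' _ <-] ne [v' [s [j e]]]].
  have [[/(place_inj ha hc) ev ->]|[/(place_inj ha hc) ev ->]] := segment_inj ne e.
    by exists s, j; rewrite ev.
  by exists (~~ s), (back v'.1 j); rewrite ev step_back.
move=> [s [j ->]]; split; [by exists v|by exists (step v s j)| |by exists v, s, j].
by move=> /(place_inj ha hc)/esym/step_neq.
Qed.

Lemma circuit_consecutive v i : consecutive_edges (circuit_face a c b v i)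
  (circuit_link a c b v i) (circuit_link a c b v i.+1).
Proof.
right; rewrite /circuit_face /circuit_link /= negbK; case: ifP => oi.
  (* Read upwards, the face around [v] passes first through the edge below [v], then through the one
     above. *)
  exists (fun k => place (spiral_vertex b v (circuit_index b v i) (- k))), (-1).
  have -> : circuit_index b v i.+1 = circuit_index b v i - chi b v.2.
    by rewrite /circuit_index /= uphalf_half oi add1n -[in LHS]natr1; ring.
  rewrite (_ : - 1 + 1 = 0) // (_ : - 1 + 2 = 1) // oppr0 opprK.
  rewrite spiral_vertex0 spiral_vertex1 spiral_vertexN1; split.
  - by move=> k k' /(place_inj ha hc)/spiral_vertex_inj/oppr_inj.
  - exact: (esym (infinite_polygon_rev (fun k => place (spiral_vertex _ _ _ k)))).
  - by rewrite segmentC.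
  - by [].
have -> : circuit_index b v i.+1 = circuit_index b v i.
  by rewrite /circuit_index /= uphalf_half oi.
set j := circuit_index b v i.
(* Numbered from its axial vertex just above [v], the flank has [v] as vertex number 1. *)
exists (fun k => place (spiral_vertex b (step v true j) (back v.1 j) k)), 0.
rewrite !add0r spiral_vertex0 spiral_vertex1 step_back.
rewrite (spiral_vertex_even _ _ _ 1); split.
- by move=> k k' /(place_inj ha hc)/spiral_vertex_inj.
- by [].
- by rewrite segmentC.
- by rewrite /link /step /=; congr segment; congr place; congr pair; ring.
Qed.

End Transitivity.

(** * The orbits of the group, the given spiral and the octagon *)

Section Identification.
Variables (R : realType) (a c : R).
Local Notation place := (place a c).
Local Notation link := (link a c).
Local Notation face := (face a c).
Local Notation word_map := (word_map a c).

Lemma GammaE : Gamma a c = range word_map.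
Proof.
have Gm i : Gamma a c (mirror_map a c i).
  by apply: generated_gen; case: i => /=; tauto.
apply/seteqP; split=> [g|_ [w _ <-]]; last first.
  elim: w => [|i w IH]; first exact: generated_id.
  exact: (generated_comp (Gm i) IH).
elim=> {g}.
- by exists [::].
- move=> g [[[[->|->]|->]|->]|->].
  + by exists [:: M0].
  + by exists [:: M1].
  + by exists [:: M2].
  + by exists [:: M3].
  + by exists [:: M4].
- by move=> _ _ _ [w _ <-] _ [w' _ <-]; exists (w ++ w'); rewrite // word_map_cat.
- move=> _ h _ [w _ <-] _ hK; exists (rev w) => //.
  by apply/funext => x; rewrite -[in LHS](hK x) word_mapK.
Qed.

Lemma place_origin : place origin = pu R.
Proof. by rewrite /place /= !mul0r. Qed.

Lemma VE : V a c = range place.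
Proof.
rewrite /V -place_origin.
apply/seteqP; split=> [_ [g + <-]|_ [v _ <-]].
  by rewrite GammaE => -[w _ <-]; rewrite word_place; exists (word_vertex w origin).
have [w _ wv] := word_origin v; exists (word_map w); first by rewrite GammaE; exists w.
by rewrite word_place wv.
Qed.

Lemma base_linkE : base_link a c = segment (pu R) (up c (pv a)).
Proof.
rewrite /base_link /link /up /pv /pu ptD; congr segment;
  by rewrite /place /step /=; congr pt; field.
Qed.

Lemma EE : E a c = [set e | exists v s j, e = link v s j].
Proof.
rewrite /E -base_linkE; apply/seteqP; split=> [_ [g + <-]|_ [v [s [j ->]]]].
  rewrite GammaE => -[w _ <-]; have [s [j ->]] := word_link a c w origin true 1.
  by exists (word_vertex w origin), s, j.
have [w _ <-] := link_orbit a c v s j.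
by exists (word_map w) => //; rewrite GammaE; exists w.
Qed.

(** The site of [px] is [(KC, 0, -1)]; its neighbours in the directions 0 to 3 are the sites of
    [py], [pu], [pz] and [ptt]. *)
Lemma spiral_face : infinite_polygon (spiral a c) = face false ((KC, 0, -1), 0) 0.
Proof.
congr infinite_polygon; apply/funext => k.
have [m [->|->]] := int_parity k.
  rewrite spiral_even spiral_vertex_even /place /px ptN ptD /=.
  by rewrite sub0r !(intrN, intrM); congr pt; field.
rewrite spiral_odd spiral_vertex_odd [chi _ _](_ : _ = 1) // mul1r add0r sub0r.
(* Both the direction in ['Z_4] and [spiral_side] depend only on the remainder of [m] modulo 4,
   which leaves four cases. *)
have -> : (m%:~R : 'Z_4) = (`|(m %% 4)%Z|%N)%:R.
  rewrite [in LHS](divz_eq m 4) rmorphD rmorphM /=.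
  have -> : (4%:~R : 'Z_4) = 0 by apply: val_inj.
  rewrite mulr0 add0r -[in LHS](gez0_abs (modz_ge0 m (_ : 4 != 0))) //.
have : (`|(m %% 4)%Z| < 4)%N by lia.
rewrite /spiral_side; case: `|_|%N => [|[|[|[|//]]]] _ /=;
  rewrite /py /pu /pz /ptt ptN ptD /place /= !(intrN, intrD, intrM);
  by congr pt; field.
Qed.

Lemma vertex_figureE (i : 'I_8) :
  tnth [tuple up c (px a); Defs.down c (px a); up c (pw a); Defs.down c (pw a);
              up c (pv a); Defs.down c (pv a); up c (py a); Defs.down c (py a)] i =
  place (step origin (~~ odd i) (circuit_index false origin i)).
Proof.
rewrite (tnth_nth 0); case: i => -[|[|[|[|[|[|[|[|//]]]]]]]] ? /=;
  rewrite /up /Defs.down /px /pw /pv /py ?ptN ptD /place /step /=;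
  by congr pt; field.
Qed.

Hypotheses (ha : 0 < a) (hc : 0 < c).

Lemma vertex_figure_origin :
  is_vertex_figure (spiralhedron a c false) (pu R) (octagon a c).
Proof.
rewrite -place_origin; exists 8%N, (tnth
  [tuple up c (px a); Defs.down c (px a); up c (pw a); Defs.down c (pw a);
         up c (pv a); Defs.down c (pv a); up c (py a); Defs.down c (py a)]).
split=> //.
- move=> i j; rewrite !vertex_figureE => /(place_inj ha hc)/step_inj[/negb_inj oij].
  by move=> /(circuit_index_inj (ltn_ord i) (ltn_ord j) oij)/val_inj.
- rewrite (adjacentE false ha hc); apply/seteqP; split=> [_ [i _ <-]|_ [s [j ->]]].
    by rewrite vertex_figureE; exists (~~ odd i), (circuit_index false origin i).
  have [i i8 [oi <-]] := circuit_index_surj false origin s j.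
  by exists (Ordinal i8); rewrite // vertex_figureE /= oi negbK.
- move=> k; exists (circuit_face a c false origin k).
    exact: circuit_face_face.
  have := circuit_consecutive false ha hc origin k.
  rewrite -[circuit_link _ _ _ _ k.+1]circuit_link_mod.
  by rewrite !vertex_figureE.
Qed.

End Identification.

Theorem proposition1 (R : realType) (a c : R) (ha : 0 < a) (hc : 0 < c) :
  exists S1 : prepolyhedron R,
    [/\ is_polyhedron S1 /\ fully_transitive S1,
        verts S1 = V a c,
        edges S1 = E a c,
        faces S1 (infinite_polygon (spiral a c)) &
        is_vertex_figure S1 (pu R) (octagon a c)].
Proof.
exists (spiralhedron a c false); split.
- split; first exact: spiralhedron_polyhedron.
  exact: spiralhedron_fully_transitive.
- by rewrite VE.
- by rewrite EE.
- by rewrite spiral_face; exists ((KC, 0, -1), 0), 0.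
- exact: vertex_figure_origin.
Qed.
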